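(* Let $S\subseteq\{0,1\}^n$ be an up-monotone cube-ideal set-system with connectivity $\lambda\geq1$. Then $S$ has VC dimension at least $(1-1/\lambda)n$.
   Context: A set-system is a subset $S\subseteq\{0,1\}^n$ with convex hull $\mathrm{conv}(S)$. It is up-monotone if $p\geq q$ (coordinatewise) with $p,q\in\{0,1\}^n$ and $q\in S$ imply $p\in S$. A GSC inequality is $\sum_{i\in I}x_i+\sum_{j\in J}(1-x_j)\geq1$ for disjoint $I,J\subseteq[n]$, using $|I|+|J|$ variables; capacity inequalities are $x_i\geq0$, $x_i\leq1$. $S$ is cube-ideal if $\mathrm{conv}(S)$ is the solution set of a finite family of capacity and GSC inequalities. The connectivity of $S$ is the minimum number of variables in a GSC inequality valid for $\mathrm{conv}(S)$ ($+\infty$ if $S=\{0,1\}^n$, with $1/\lambda$ then read as $0$). The VC dimension of $S$ is the largest $d$ such that for some $I\subseteq[n]$ with $|I|=d$, the restrictions $\{p_I:p\in S\}$ give all of $\{0,1\}^I$ ($0$ if $S=\emptyset$). *)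

(* Defs.v *)
From mathcomp Require Import all_boot all_order all_algebra.
From mathcomp Require Import all_classical all_reals ereal.

Set Implicit Arguments.
Unset Strict Implicit.
Unset Printing Implicit Defensive.

Import Order.TTheory GRing.Theory Num.Theory.
Local Open Scope ring_scope.
Local Open Scope classical_set_scope.

Definition cube (n : nat) : finType := {ffun 'I_n -> bool}.

Definition setsystem (n : nat) : Type := {set cube n}.

Definition up_monotone (n : nat) (S : setsystem n) : Prop :=
  forall p q : cube n, (forall i, (q i <= p i)%N) -> q \in S -> p \in S.

Definition vertex (R : realType) (n : nat) (p : cube n) : 'rV[R]_n :=
  \row_i (p i)%:R.

Definition conv_hull (R : realType) (n : nat) (S : setsystem n) : set 'rV[R]_n :=
  [set x | exists w : cube n -> R,
     [/\ forall p, p \in S -> 0 <= w p,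
         \sum_(p in S) w p = 1
       & x = \sum_(p in S) w p *: vertex R p]].
Arguments conv_hull R {n} S.

(* [GSC A B] is only meant for disjoint [A] and [B]; see [wf_ineq]. *)
Inductive ineq (n : nat) : Type :=
  | CapLower of 'I_n
  | CapUpper of 'I_n
  | GSC of {set 'I_n} & {set 'I_n}.

Definition wf_ineq (n : nat) (c : ineq n) : bool :=
  if c is GSC A B then [disjoint A & B] else true.

Definition satisfies (R : realType) (n : nat) (x : 'rV[R]_n) (c : ineq n)
    : bool :=
  match c with
  | CapLower i => 0 <= x 0 i
  | CapUpper i => x 0 i <= 1
  | GSC A B => \sum_(i in A) x 0 i + \sum_(j in B) (1 - x 0 j) >= 1
  end.

Definition cube_ideal (R : realType) (n : nat) (S : setsystem n) : Prop :=
  exists F : seq (ineq n),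
    all (@wf_ineq n) F /\ conv_hull R S = [set x | all (satisfies x) F].

Definition valid (R : realType) (n : nat) (S : setsystem n) (c : ineq n)
    : Prop :=
  forall x : 'rV[R]_n, conv_hull R S x -> satisfies x c.

(* The value is [+oo] when no GSC inequality is valid, i.e. when [S] is the
   whole cube; it is [0] when [S] is empty, as [GSC set0 set0] reads 0 >= 1. *)
Definition connectivity (R : realType) (n : nat) (S : setsystem n) : \bar R :=
  \big[Order.min/+oo%E]_(IJ : {set 'I_n} * {set 'I_n} |
      [disjoint IJ.1 & IJ.2] && `[< valid R S (GSC IJ.1 IJ.2) >])
    ((#|IJ.1| + #|IJ.2|)%:R)%:E.

Definition restriction (n : nat) (I : {set 'I_n}) (p : cube n)
    : {ffun {i : 'I_n | i \in I} -> bool} :=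
  [ffun i => p (val i)].

Definition shattered (n : nat) (S : setsystem n) (I : {set 'I_n}) : bool :=
  [set restriction I p | p in S]%SET
    == [set: {ffun {i : 'I_n | i \in I} -> bool}]%SET.

Definition VCdim (n : nat) (S : setsystem n) : nat :=
  \max_(I : {set 'I_n} | shattered S I) #|I|.

(* Main.v *)
Require Import Defs.
From mathcomp Require Import all_boot all_order all_algebra.
From mathcomp Require Import all_classical all_reals ereal.

Set Implicit Arguments.
Unset Strict Implicit.
Unset Printing Implicit Defensive.

Import Order.TTheory GRing.Theory Num.Theory.
Local Open Scope ring_scope.

(** For an up-monotone [S], a valid inequality [GSC A B] can be strengthened to
    [GSC A set0]. Hence, for a cube-ideal [S], a point of the unit cube belongs
    to [conv S] as soon as its coordinates in [A] add up to at least 1 whenever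
    [GSC A set0] is valid. Such an [A] has at least [lambda] elements, where
    [lambda] is the connectivity, so [conv S] contains the constant vector
    [1 / lambda] (the zero vector if [lambda = +oo]). By averaging, some point
    of [S] has at most [n / lambda] ones; its set of zeros is shattered. *)

Section InverseEreal.
Context {R : realFieldType}.
Implicit Types x y : \bar R.

Lemma inve_itv01 x : (1 <= x)%E -> exists2 c : R, 0 <= c <= 1 & x^-1%E = c%:E.
Proof.
move=> x_ge1; have x_gt0 : (0 < x)%E by exact: lt_le_trans x_ge1.
have xV_fin : (x^-1)%E \is a fin_num.
  by rewrite fin_numV ?gt_eqF // (lt_trans _ x_gt0).
exists (fine x^-1); last by rewrite fineK.
rewrite -!lee_fin fineK // inve_ge0 (ltW x_gt0) /=.
by rewrite inve_ple ?inE ?inve1 // ltW.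
Qed.

Lemma inve_mule_ge1 x y :
  (0 < x)%E -> (x <= y)%E -> y \is a fin_num -> (1 <= x^-1 * y)%E.
Proof.
move=> x_gt0 le_xy y_fin.
have x_fin : x \is a fin_num.
  by rewrite ge0_fin_numE ?(ltW x_gt0) // (le_lt_trans le_xy) // ltey_eq y_fin.
rewrite -(mulVe _ x_fin) ?gt_eqF //.
by apply: lee_wpmul2l => //; rewrite inve_ge0 ltW.
Qed.

End InverseEreal.

Section ConvexHull.
Context {R : realType} {n : nat}.
Implicit Types (S : setsystem n) (p : cube n) (A B : {set 'I_n}).
Implicit Types (x : 'rV[R]_n) (c : ineq n).

Lemma conv_hull_vertex S p : p \in S -> conv_hull R S (vertex R p).
Proof.
move=> pS; exists (fun q => (q == p)%:R); split=> [q _||].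
- by rewrite ler0n.
- by rewrite (bigD1 p) //= eqxx big1 ?addr0 // => q /andP[_ /negPf ->].
- rewrite (bigD1 p) //= eqxx scale1r big1 ?addr0 // => q /andP[_ /negPf ->].
  by rewrite scale0r.
Qed.

Lemma conv_hull_sub_halfspace S (a : 'I_n -> R) (b : R) x :
  (forall p, p \in S -> b <= \sum_i a i * vertex R p 0 i) ->
  conv_hull R S x -> b <= \sum_i a i * x 0 i.
Proof.
move=> vertex_ge [w [w_ge0 w_sum1 ->]].
have -> : \sum_i a i * (\sum_(p in S) w p *: vertex R p) 0 i
    = \sum_(p in S) w p * \sum_i a i * vertex R p 0 i.
  under eq_bigr do rewrite summxE mulr_sumr.
  rewrite exchange_big; apply: eq_bigr => p _; rewrite mulr_sumr.
  by apply: eq_bigr => i _; rewrite !mxE mulrCA.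
rewrite -[b]mul1r -w_sum1 mulr_suml; apply: ler_sum => p pS.
by rewrite ler_wpM2l ?w_ge0 ?vertex_ge.
Qed.

Lemma satisfies_halfspace c :
  exists (a : 'I_n -> R) (b : R),
    forall x, satisfies x c = (b <= \sum_i a i * x 0 i).
Proof.
pose sgn A B (i : 'I_n) : R := (i \in A)%:R - (i \in B)%:R.
have sgnE A B x :
    \sum_i sgn A B i * x 0 i = \sum_(i in A) x 0 i - \sum_(i in B) x 0 i.
  rewrite [in RHS]big_mkcond [X in _ - X]big_mkcond -sumrB.
  by apply: eq_bigr => i _; rewrite mulrBl !mulr_natl !mulrb.
case: c => [i|i|A B].
- exists (sgn [set i]%SET finset.set0), 0 => x.
  by rewrite sgnE big_set1 big_set0 subr0.
- exists (sgn finset.set0 [set i]%SET), (-1) => x.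
  by rewrite sgnE big_set1 big_set0 sub0r lerN2.
- exists (sgn A B), (1 - #|B|%:R) => x.
  by rewrite sgnE /= sumrB sumr_const lerBlDr addrAC addrA.
Qed.

Lemma valid_vertexP S c :
  valid R S c <-> forall p, p \in S -> satisfies (vertex R p) c.
Proof.
split=> [validc p pS | vertex_sat x]; first exact/validc/conv_hull_vertex.
have [a [b satE]] := satisfies_halfspace c.
rewrite satE; apply: conv_hull_sub_halfspace => p /vertex_sat.
by rewrite satE.
Qed.

Lemma cube_ideal_conv_hull S x : cube_ideal R S ->
  (forall c, wf_ineq c -> valid R S c -> satisfies x c) -> conv_hull R S x.
Proof.
move=> [F [wfF convE]] valid_sat; rewrite convE.
pose c0 : ineq n := GSC finset.set0 finset.set0.
apply/(all_nthP c0) => k ltkF.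
apply: valid_sat; first exact: all_nthP wfF k ltkF.
by move=> y; rewrite convE => /(all_nthP c0); apply.
Qed.

End ConvexHull.

Section UpMonotone.
Context {R : realType} {n : nat} (S : setsystem n).
Hypothesis upS : up_monotone S.
Implicit Types (p : cube n) (A B : {set 'I_n}) (x : 'rV[R]_n).

(* Raising the coordinates of a point of [S] to 1 on [B] stays inside [S], and
   there the second sum of the inequality vanishes. *)
Lemma valid_GSC_up_monotone A B : [disjoint A & B] ->
  valid R S (GSC A B) -> valid R S (GSC A finset.set0).
Proof.
move=> disjAB /valid_vertexP validAB; apply/valid_vertexP => p pS.
pose q : cube n := [ffun i => p i || (i \in B)].
have qS : q \in S by apply: upS pS => i; rewrite ffunE; case: (p i).
have := validAB _ qS; rewrite /= big_set0.
rewrite [X in _ + X]big1 => [|i iB]; last by rewrite mxE ffunE iB orbT subrr.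
rewrite (eq_bigr (fun i => vertex R p 0 i)) // => i iA.
by rewrite !mxE ffunE (disjointFr disjAB iA) orbF.
Qed.

Lemma fractional_cover_conv_hull x : cube_ideal R S ->
  (forall i, 0 <= x 0 i <= 1) ->
  (forall A, valid R S (GSC A finset.set0) -> 1 <= \sum_(i in A) x 0 i) ->
  conv_hull R S x.
Proof.
move=> idealS x01 cover; apply: cube_ideal_conv_hull => // -[i|i|A B] /= disjAB.
- by case/andP: (x01 i).
- by case/andP: (x01 i).
move=> /(valid_GSC_up_monotone disjAB)/cover/le_trans; apply.
by rewrite lerDl sumr_ge0 // => i _; rewrite subr_ge0; case/andP: (x01 i).
Qed.

Lemma shattered_zeros p : p \in S -> shattered S [set i | ~~ p i]%SET.
Proof.
move=> pS; apply/eqP/setP => f; rewrite inE.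
pose q : cube n := [ffun i => if insub i is Some j then f j else true].
apply/imsetP; exists q; last by apply/ffunP => j; rewrite !ffunE valK.
apply: upS pS => i; rewrite ffunE.
by case: insubP => [j|]; rewrite inE ?negbK; case: (p i).
Qed.

Lemma VCdim_ge_conv_hull x :
  conv_hull R S x -> n%:R - \sum_i x 0 i <= (VCdim S)%:R.
Proof.
move=> xS; rewrite lerBlDr addrC -lerBlDr.
under eq_bigr do rewrite -[x 0 _]mul1r.
apply: (conv_hull_sub_halfspace _ xS) => p pS.
have sum_vertexE :
    \sum_i 1 * vertex R p 0 i = n%:R - #|[set i | ~~ p i]%SET|%:R.
  have -> : n%:R = \sum_(i < n) 1 :> R by rewrite sumr_const card_ord.
  rewrite -sum1_card natr_sum [X in _ - X]big_mkcond -sumrB.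
  apply: eq_bigr => i _; rewrite mul1r mxE inE.
  by case: (p i); rewrite ?subrr ?subr0.
rewrite sum_vertexE lerB ?ler_nat //.
exact: leq_bigmax_cond (shattered_zeros pS).
Qed.

End UpMonotone.

Lemma connectivity_le (R : realType) (n : nat) (S : setsystem n)
    (A B : {set 'I_n}) : [disjoint A & B] -> valid R S (GSC A B) ->
  (connectivity R S <= ((#|A| + #|B|)%:R)%:E)%E.
Proof.
move=> disjAB validAB; apply: (bigmin_le_cond _ (j := (A, B))).
by rewrite /= disjAB; apply/asboolP.
Qed.

Theorem theorem5p2 (R : realType) (n : nat) (S : setsystem n)
    (hup : up_monotone S) (hideal : cube_ideal R S)
    (hconn : (1 <= connectivity R S)%E) :
  ((1 - (connectivity R S)^-1) * n%:R%:E <= (VCdim S)%:R%:E)%E.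
Proof.
have conn_gt0 : (0 < connectivity R S)%E by exact: lt_le_trans hconn.
have [c c01 inv_conn] := inve_itv01 hconn.
have cover A : valid R S (GSC A finset.set0) ->
    1 <= \sum_(i in A) (const_mx c : 'rV[R]_n) 0 i.
  have disjA0 : [disjoint A & finset.set0].
    by rewrite disjoint_sym eq_disjoint0 // => i; rewrite inE.
  move=> /(connectivity_le disjA0)/(inve_mule_ge1 conn_gt0)/(_ isT).
  under eq_bigr do rewrite mxE.
  by rewrite cards0 addn0 inv_conn sumr_const -[c *+ _]mulr_natr.
have : conv_hull R S (const_mx c).
  by apply: (fractional_cover_conv_hull hup hideal _ cover) => i; rewrite mxE.
move=> /(VCdim_ge_conv_hull hup); under eq_bigr do rewrite mxE.
rewrite sumr_const card_ord -[c *+ _]mulr_natr.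
by rewrite inv_conn -EFinB -EFinM lee_fin mulrBl mul1r.
Qed.
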